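(* Let $\mathcal{H}_1=\{H_{1,1},\dots,H_{1,r}\}$ be a finite family of tournaments with the $(\mathcal{F},v,\eta)$-strong EH-property and $\mathcal{H}_2=\{H_{2,1},\dots,H_{2,s}\}$ a finite family of tournaments with the $(\mathcal{G},v,\eta)$-strong EH-property (same $v,\eta$), where the vertex sets of the tournaments of $\mathcal{H}_1$ are disjoint from those of $\mathcal{H}_2$, and assume $\langle\mathcal{F},\mathcal{G}\rangle=0$. Then the family $\mathcal{H}=\mathcal{H}_1^{\mathcal{F}}\oplus\mathcal{H}_2^{\mathcal{G}}$ has the $(\mathcal{F}\oplus\mathcal{G},v,\eta)$-strong EH-property.
   Context: Tournaments are finite; subtournament = induced subtournament; transitive = no directed cycle; $tr(T)$ = maximum size of a transitive subtournament of $T$. $V_1$ is complete to $V_2$ if every vertex of $V_1$ has an edge to every vertex of $V_2$. For disjoint nonempty $X,Y$, $d(X,Y)=e_{X,Y}/(|X||Y|)$, $e_{X,Y}$ = number of edges $(x,y)$ with $x\in X,y\in Y$. For a $\{0,1\}$-vector $v$ of length $m$, $\zeta^v(i)=|\{j\le i:v(j)=1\}|$; $\eta$ is a vector of positive integers of length $\zeta^v(m)$; $k=|\{j:v(j)=0\}|+\sum_i\eta(i)$. For a tournament $T$, $c>0$, $0\le\lambda<1$, a $(v,\eta,c,\lambda)$-m-sequence in $T$ is a sequence $\chi=(S_1,\dots,S_m)$ of pairwise disjoint subsets of $V(T)$ such that: if $v(i)=1$, $S_i$ induces a transitive subtournament partitioned into $S_{i,1},\dots,S_{i,\eta(\zeta^v(i))}$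 with $S_{i,a}$ complete to $S_{i,b}$ for $a<b$ and $|S_{i,a}|\ge c\,tr(T)$; if $v(i)=0$, $|S_i|\ge c|T|$; $d(S_i,S_j)\ge1-\lambda$ for $i<j$. Its long representation $l(\chi)=(T_1,\dots,T_k)$ replaces each $S_i$ with $v(i)=1$ by $S_{i,1},\dots,S_{i,\eta(\zeta^v(i))}$ in order; $V(\chi)=\bigcup S_i$. A $c'$-strong pair in $\chi$ is a pair $(A,B)$ of disjoint subsets of $V(\chi)$ with $|A|\ge c'|T|$, either $|B|\ge c'|T|$ or ($B$ transitive and $|B|\ge c'\,tr(T)$), and $d(A,B)=1$ or $d(B,A)=1$. For $\mathcal{H}=\{H_1,\dots,H_t\}$, $V(H_i)=\{h^i_1,\dots\}$, and $\mathcal{F}=\{f_1,\dots,f_t\}$ with $f_i:V(H_i)\to\{1,\dots,k\}$ injective ($f_i$ associated with $H_i$), $\mathcal{H}$ has the $(\mathcal{F},v,\eta)$-strong EH-property if for every $c_1>0$ there exist $\lambda_0>0,c_2>0$ such that for every tournament $T$, $0\le\lambda\le\lambda_0$ and $(v,\eta,c_1,\lambda)$-m-sequence $\chi$ in $T$ with $l(\chi)=(T_1,\dots,T_k)$, either there are $i$ and $x_j\in T_{f_i(h^i_j)}$ with $x_j\mapsto h^i_j$ an isomorphism from the subtournament induced on $\{x_j\}$ onto $H_i$, or $\chi$ contains a $c_2$-strong pair. Products: an edge $(x,y)$ is backward under an ordering if $y$ precedes $x$. For tournaments $H_1,H_2$ with disjoint vertex sets and injective $f_1:V(H_1)\to\mathbb{N}$,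 $f_2:V(H_2)\to\mathbb{N}$ with $f_1(x)\ne f_2(y)$ for all $x,y$ (written $\langle f_1,f_2\rangle=0$), let $f_1\oplus f_2$ be the function on $V(H_1)\cup V(H_2)$ equal to $f_1$ on $V(H_1)$ and $f_2$ on $V(H_2)$; let $\theta_i$ be the ordering of $V(H_i)$ by increasing $f_i$ and $\theta$ that of $V(H_1)\cup V(H_2)$ by increasing $f_1\oplus f_2$. The product $H_1^{f_1}\oplus H_2^{f_2}$ is the tournament on $V(H_1)\cup V(H_2)$ whose backward edges under $\theta$ are exactly the backward edges of $H_1$ under $\theta_1$ together with the backward edges of $H_2$ under $\theta_2$. For families $\mathcal{F}=\{f_1,\dots,f_r\}$, $\mathcal{G}=\{g_1,\dots,g_s\}$: $\langle\mathcal{F},\mathcal{G}\rangle=0$ means $\langle f,g\rangle=0$ for all $f\in\mathcal{F},g\in\mathcal{G}$; $\mathcal{F}\oplus\mathcal{G}=\{f_i\oplus g_j\}$; and $\mathcal{H}_1^{\mathcal{F}}\oplus\mathcal{H}_2^{\mathcal{G}}=\{H_{1,i}^{f_i}\oplus H_{2,j}^{g_j}\}$, where the member $H_{1,i}^{f_i}\oplus H_{2,j}^{g_j}$ is associated with the function $f_i\oplus g_j$. *)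

(* Defs.v *)
From HB Require Import structures.
From mathcomp Require Import all_boot all_order all_algebra.
From mathcomp Require Import boolp reals.
Set Implicit Arguments.
Unset Strict Implicit.
Unset Printing Implicit Defensive.
Import Order.TTheory GRing.Theory Num.Theory.
Local Open Scope ring_scope.

Record tournament := Tournament {
  vertex :> finType;
  arc : rel vertex;
  arc_irr : irreflexive arc;
  arc_tot : forall x y, x != y -> arc x y = ~~ arc y x
}.

Definition transitive_set (T : tournament) (A : {set T}) : Prop :=
  forall c : seq T, c != [::] -> {subset c <= A} -> ~ ucycle (@arc T) c.

Definition tr (T : tournament) : nat :=
  \max_(A : {set T} | `[< transitive_set A >]) #|A|.

Definition complete_to (T : tournament) (A B : {set T}) : Prop :=
  forall x y, x \in A -> y \in B -> arc x y.

(* Only meaningful for nonempty A and B; division by zero gives 0 otherwise,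
   so neither [1 - lambda <= density R A B] with [lambda < 1] nor
   [density R A B = 1] holds when A or B is empty. *)
Definition density (R : realType) (T : tournament) (A B : {set T}) : R :=
  #|[set p in setX A B | arc p.1 p.2]|%:R / (#|A| * #|B|)%:R.

(* Positions are 0-based: entry i : 'I_m is the (i+1)-st entry in the usual
   numbering from 1, so zeta there takes the value [zeta v i.+1]. *)
Definition zeta (m : nat) (v : m.-tuple bool) (i : nat) : nat :=
  count id (take i v).

Section MSequence.
Variables (m : nat) (v : m.-tuple bool) (eta : (zeta v m).-tuple nat).

Definition long_size : nat := (count negb v + sumn eta)%N.

Definition eta_at (i : 'I_m) : nat := nth 0%N eta (zeta v i.+1).-1.

(* The decomposition of a transitive S_i is not determined by S_i, so it is
   part of the data.  Only the values [mpart i a] with [tnth v i] and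
   [a < eta_at i] are ever used. *)
Record mseq (T : tournament) := MSeq {
  mset : 'I_m -> {set T};
  mpart : 'I_m -> nat -> {set T}
}.

Definition is_mseq (R : realType) (c lambda : R) (T : tournament)
    (chi : mseq T) : Prop :=
  [/\ forall i j, i != j -> [disjoint mset chi i & mset chi j],
      forall i, tnth v i ->
        [/\ transitive_set (mset chi i),
            mset chi i = \bigcup_(a < eta_at i) mpart chi i a,
            forall a b, (a < b < eta_at i)%N ->
              [disjoint mpart chi i a & mpart chi i b],
            forall a b, (a < b < eta_at i)%N ->
              complete_to (mpart chi i a) (mpart chi i b)
          & forall a, (a < eta_at i)%N ->
              c * (tr T)%:R <= #|mpart chi i a|%:R],
      forall i, ~~ tnth v i -> c * #|T|%:R <= #|mset chi i|%:R
    & forall i j : 'I_m, (i < j)%N ->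
        1 - lambda <= density R (mset chi i) (mset chi j)].

Definition long_repr (T : tournament) (chi : mseq T) : seq {set T} :=
  flatten [seq (if tnth v i then [seq mpart chi i a | a <- iota 0 (eta_at i)]
                else [:: mset chi i]) | i <- enum 'I_m].

Lemma size_long_repr (T : tournament) (chi : mseq T) :
  size (long_repr chi) = long_size.
Proof.
rewrite /long_repr size_flatten /shape -map_comp /long_size.
have -> : map (size \o fun i : 'I_m => if tnth v i
      then [seq mpart chi i a | a <- iota 0 (eta_at i)]
      else [:: mset chi i]) (enum 'I_m)
    = [seq (if nth false v i then nth 0%N eta (count id (take i.+1 v)).-1
            else 1%N) | i <- iota 0 (size v)].
  rewrite size_tuple -val_enum_ord -map_comp; apply: eq_map => i /=.
  by rewrite (tnth_nth false); case: ifP; rewrite // size_map size_iota.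
have : size eta = count id v by rewrite size_tuple /zeta take_oversize ?size_tuple.
move: (tval v) (tval eta) => {chi} w; elim: w => [|b w IHw] e /=.
  by move/size0nil ->.
rewrite take0 addn0 -[in iota 1 _](addn0 1%N) iotaDl -map_comp.
case: b => /=.
- case: e => //= a e [/IHw {}IHw].
  rewrite add0n addnCA -IHw; congr (_ + sumn _)%N.
  apply/eq_in_map => i; rewrite mem_iota add0n /= => ltiw.
  case: ifP => // wi; rewrite add1n /=.
  suff : (0 < count id (take i.+1 w))%N by case: (count _ _).
  by rewrite (take_nth false) // -cats1 count_cat /= wi addnA addn1 addn0.
- by move/IHw => {}IHw; rewrite -addnA -IHw.
Qed.

Definition mvert (T : tournament) (chi : mseq T) : {set T} :=
  \bigcup_(i < m) mset chi i.

Definition strong_pair (R : realType) (c : R) (T : tournament) (chi : mseq T)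
    (A B : {set T}) : Prop :=
  [/\ [disjoint A & B],
      A \subset mvert chi /\ B \subset mvert chi,
      c * #|T|%:R <= #|A|%:R,
      c * #|T|%:R <= #|B|%:R \/
        (transitive_set B /\ c * (tr T)%:R <= #|B|%:R)
    & density R A B = 1 \/ density R B A = 1].

(* The host tournament T is nonempty: the size conditions say nothing about
   an empty T.  Labels in {1, ..., k} are elements of 'I_k. *)
Definition strong_EH (R : realType) (I : finType) (H : I -> tournament)
    (f : forall i, H i -> 'I_long_size) : Prop :=
  forall c1 : R, 0 < c1 ->
  exists lambda0 c2 : R, [/\ 0 < lambda0, 0 < c2 &
    forall (T : tournament) (lambda : R) (chi : mseq T),
      (0 < #|T|)%N -> 0 <= lambda < 1 -> lambda <= lambda0 ->
      is_mseq c1 lambda chi ->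
      (exists (i : I) (x : H i -> T),
         [/\ forall h, x h \in nth set0 (long_repr chi) (f i h),
             injective x
           & forall h h', arc (x h) (x h') = arc h h'])
      \/ (exists A B : {set T}, strong_pair c2 chi A B)].

End MSequence.

Arguments strong_EH {m} v eta R {I} H f.

Definition oplus (V1 V2 D : Type) (f1 : V1 -> D) (f2 : V2 -> D)
    (z : V1 + V2) : D :=
  match z with inl x => f1 x | inr y => f2 y end.

Definition orth (V1 V2 D : Type) (f1 : V1 -> D) (f2 : V2 -> D) : Prop :=
  forall x y, f1 x <> f2 y.

Lemma oplus_inj (V1 V2 D : Type) (f1 : V1 -> D) (f2 : V2 -> D) :
  injective f1 -> injective f2 -> orth f1 f2 -> injective (oplus f1 f2).
Proof.
move=> i1 i2 o [x|x] [y|y] /= e.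
- by rewrite (i1 _ _ e).
- by case: (o _ _ e).
- by case: (o y x); rewrite e.
- by rewrite (i2 _ _ e).
Qed.

Definition backward (H : tournament) (f : H -> nat) : rel H :=
  fun x y => arc x y && (f y < f x)%N.

Section Product.
Variables (H1 H2 : tournament) (f1 : H1 -> nat) (f2 : H2 -> nat).

Definition prod_backward : rel (H1 + H2) := fun z w =>
  match z, w with
  | inl x, inl y => backward f1 x y
  | inr x, inr y => backward f2 x y
  | _, _ => false
  end.

Definition prod_arc : rel (H1 + H2) := fun z w =>
  if (oplus f1 f2 w < oplus f1 f2 z)%N then prod_backward z w
  else (oplus f1 f2 z < oplus f1 f2 w)%N && ~~ prod_backward w z.

Hypotheses (inj1 : injective f1) (inj2 : injective f2) (f12 : orth f1 f2).

Lemma prod_arc_irr : irreflexive prod_arc.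
Proof. by move=> z; rewrite /prod_arc ltnn. Qed.

Lemma prod_arc_tot z w : z != w -> prod_arc z w = ~~ prod_arc w z.
Proof.
move=> zw; have : oplus f1 f2 z != oplus f1 f2 w.
  by apply: contra_neq zw; apply: oplus_inj.
by rewrite /prod_arc; case: ltngtP => //= _ _; rewrite ?negbK.
Qed.

(* The disjoint union of the vertex sets is the sum type. *)
Definition tprod : tournament := Tournament prod_arc_irr prod_arc_tot.

Lemma tprod_backward : @backward tprod (oplus f1 f2) =2 prod_backward.
Proof.
move=> z w; rewrite /backward /= /prod_arc.
case: ifP => [_|ngt]; rewrite ?andbT ?andbF //.
by case: z w ngt => [x|x] [y|y] //= ngt; rewrite /backward ngt andbF.
Qed.

End Product.

Lemma val_comp_inj (V : Type) (k : nat) (f : V -> 'I_k) :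
  injective f -> injective (fun x => nat_of_ord (f x)).
Proof. by move=> fi x y /val_inj /fi. Qed.

Lemma val_comp_orth (V1 V2 : Type) (k : nat) (f : V1 -> 'I_k)
    (g : V2 -> 'I_k) :
  orth f g -> orth (fun x => nat_of_ord (f x)) (fun y => nat_of_ord (g y)).
Proof. by move=> fg x y /val_inj; apply: fg. Qed.

Section ProductFamily.
Variables (k : nat) (I J : finType).
Variables (H1 : I -> tournament) (H2 : J -> tournament).
Variables (F : forall i, H1 i -> 'I_k) (G : forall j, H2 j -> 'I_k).
Hypotheses (injF : forall i, injective (@F i)).
Hypotheses (injG : forall j, injective (@G j)).
Hypothesis FG : forall i j, orth (@F i) (@G j).

Definition tprod_family (p : I * J) : tournament :=
  tprod (val_comp_inj (@injF p.1)) (val_comp_inj (@injG p.2))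
        (val_comp_orth (@FG p.1 p.2)).

Definition oplus_family (p : I * J) : tprod_family p -> 'I_k :=
  oplus (@F p.1) (@G p.2).

End ProductFamily.

Arguments tprod_family {k I J H1 H2 F G} injF injG FG p.
Arguments oplus_family {k I J H1 H2 F G} injF injG FG p _.

(* Main.v *)
(* Call x in S_p and y in S_q, p <> q, a misfit if the arc between them
   disagrees with the order of p and q.  For lambda small, a Markov argument
   shows that almost all vertices of each S_p have few misfits in every S_q;
   such vertices are called fitting.  The m-sequence cut down to the fitting
   vertices still satisfies the hypotheses for the first family, with c1 / 2
   and 4 lambda, so it contains a strong pair or a copy of some H_(1,i).  The
   copy has boundedly many vertices, so the vertices that form no misfit with
   it are again almost all of each S_q, and among these the second family
   yields a strong pair or a copy of some H_(2,j).  No misfit means that all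
   arcs between the two copies follow the long representation, so together
   they form a copy of the product. *)
From HB Require Import structures.
From mathcomp Require Import all_boot all_order all_algebra.
From mathcomp Require Import boolp reals.
From mathcomp Require Import ring lra.
Require Import Defs.

Set Implicit Arguments.
Unset Strict Implicit.
Unset Printing Implicit Defensive.
Import Order.TTheory GRing.Theory Num.Theory.
Local Open Scope ring_scope.

(** * Transitive sets, arc counts and densities *)

Lemma transitive_setS (T : tournament) (A B : {set T}) :
  A \subset B -> transitive_set B -> transitive_set A.
Proof.
by move=> /subsetP sAB tB c c0 cA; apply: tB => // x /cA /sAB.
Qed.

Lemma transitive_set_tr (T : tournament) (A : {set T}) :
  transitive_set A -> (#|A| <= tr T)%N.
Proof. by move=> tA; apply: (leq_bigmax_cond A); apply/asboolP. Qed.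

Lemma card_setX_pred (T : finType) (A B : {set T}) (P : rel T) :
  #|[set p in setX A B | P p.1 p.2]| = (\sum_(x in A) \sum_(y in B) P x y)%N.
Proof.
rewrite pair_big_dep /= -sum1_card.
rewrite [LHS](eq_bigl (fun p => ((p.1 \in A) && (p.2 \in B)) && P p.1 p.2)).
  by rewrite [LHS]big_mkcondr; apply: eq_bigr => p _; case: (P _ _).
by case=> x y; rewrite inE in_setX.
Qed.

Lemma pairwise_flatten (T : Type) (r : rel T) (ss : seq (seq T)) :
  pairwise r (flatten ss) = all (pairwise r) ss && pairwise (allrel r) ss.
Proof.
elim: ss => //= s ss IH; rewrite pairwise_cat IH.
have -> : allrel r s (flatten ss) = all (allrel r s) ss.
  by elim: ss {IH} => [|t ss IH] /=; rewrite ?allrel0r // allrel_catr IH.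
by rewrite andbCA -!andbA; congr (_ && _); rewrite andbCA.
Qed.

Lemma density_gt0_neq0 (R : realType) (T : tournament) (A B : {set T}) :
  0 < density R A B -> A != set0 /\ B != set0.
Proof.
by rewrite /density => d0; split; apply: contraTneq d0 => ->;
  rewrite cards0 ?mul0n ?muln0 invr0 mulr0 ltxx.
Qed.

Definition rev_arcs (T : tournament) (A B : {set T}) : nat :=
  \sum_(x in A) \sum_(y in B) arc y x.

(** Between disjoint sets every pair carries exactly one arc, so forward and reverse arcs add up to
    |A| |B|. Unlike the density, the reverse count is monotone in both sets. *)
Lemma density_rev_arcs (R : realType) (T : tournament) (A B : {set T})
    (lambda : R) :
  [disjoint A & B] -> A != set0 -> B != set0 ->
  (1 - lambda <= density R A B) =
  ((rev_arcs A B)%:R <= lambda * (#|A|%:R * #|B|%:R)).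
Proof.
move=> dAB; rewrite -!card_gt0 => A0 B0.
have AB0 : 0 < #|A|%:R * #|B|%:R :> R by rewrite mulr_gt0 ?ltr0n.
rewrite /density card_setX_pred natrM ler_pdivlMr // mulrBl mul1r.
suff -> : #|A|%:R * #|B|%:R =
    (\sum_(x in A) \sum_(y in B) arc x y)%:R + (rev_arcs A B)%:R :> R.
  by apply/idP/idP; lra.
rewrite -natrD -natrM; congr _%:R.
rewrite -big_split /= -sum_nat_const; apply: eq_bigr => x xA.
rewrite -big_split /= -sum1_card; apply: eq_bigr => y yB.
rewrite (@arc_tot _ x y); first by case: (arc y x).
by apply: contraTneq yB => <-; rewrite (disjointFr dAB).
Qed.

Lemma leq_sum_subset (T : finType) (A B : {set T}) (E : T -> nat) :
  A \subset B -> (\sum_(x in A) E x <= \sum_(x in B) E x)%N.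
Proof.
by move=> sAB; rewrite [leqRHS](big_setID A) (setIidPr sAB) leq_addr.
Qed.

Lemma rev_arcsS (T : tournament) (A A' B B' : {set T}) :
  A' \subset A -> B' \subset B -> (rev_arcs A' B' <= rev_arcs A B)%N.
Proof.
move=> sA sB; apply: leq_trans (leq_sum_subset _ sA).
by apply: leq_sum => x _; apply: leq_sum_subset.
Qed.

(** * Restriction of an m-sequence to a vertex set *)

Section MSequence.
Variables (m : nat) (v : m.-tuple bool) (eta : (zeta v m).-tuple nat).
Variables (R : realType) (T : tournament).
Implicit Types (chi : mseq m T) (G : {set T}).

Definition mseq_restrict chi G : mseq m T :=
  MSeq (fun i => mset chi i :&: G) (fun i a => mpart chi i a :&: G).

Lemma long_repr_restrict chi G :
  long_repr eta (mseq_restrict chi G) =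
  [seq A :&: G | A <- long_repr eta chi].
Proof.
rewrite /long_repr map_flatten -map_comp; congr flatten.
apply: eq_map => i /=; case: ifP => //= _.
by rewrite -map_comp.
Qed.

Lemma nth_long_repr_restrict chi G k :
  nth set0 (long_repr eta (mseq_restrict chi G)) k =
  nth set0 (long_repr eta chi) k :&: G.
Proof.
rewrite long_repr_restrict.
have [kl|lk] := ltnP k (size (long_repr eta chi)).
  by rewrite (nth_map set0).
by rewrite !nth_default ?set0I // size_map.
Qed.

(** Only the sequence shrinks; the host, and with it |T| and tr T, stays the same. *)
Lemma strong_pair_restrict (c c' : R) chi G A B : c' <= c ->
  strong_pair c (mseq_restrict chi G) A B -> strong_pair c' chi A B.
Proof.
move=> cc [dAB [sA sB] cA cB d].
have sub : mvert (mseq_restrict chi G) \subset mvert chi.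
  apply/bigcupsP => i _; apply: subset_trans (subsetIl _ _) _.
  exact: (bigcup_sup i).
have le_c' (n k : nat) : c * n%:R <= k%:R -> c' * n%:R <= k%:R.
  by apply: le_trans; rewrite ler_wpM2r.
split=> //; first by split; [apply: subset_trans sub|apply: subset_trans sub].
- exact: le_c'.
- by case: cB => [cB|[tB cB]]; [left|right; split=> //]; apply: le_c'.
Qed.

(* As |S_i| <= tr T for a transitive S_i (resp. <= |T|), removing a fraction
   [c / 2] of S_i leaves at least c / 2 * tr T in each part (resp. c / 2 * |T|
   in S_i); the minimum with 1 ensures that at least half of S_i is left, which
   costs a factor at most 4 in lambda. *)
Definition mostly (c : R) (A G : {set T}) : bool :=
  #|A :\: G|%:R <= Num.min c 1 / 2 * #|A|%:R.

Lemma is_mseq_restrict (c lambda : R) chi G : 0 < c -> 0 <= lambda < 1 ->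
  is_mseq eta c lambda chi -> (forall i, mostly c (mset chi i) G) ->
  is_mseq eta (c / 2) (4 * lambda) (mseq_restrict chi G).
Proof.
move=> c0 /andP[l0 l1] [disj trn big dens] mG.
have lam1 : 0 < 1 - lambda by rewrite subr_gt0.
have minc : Num.min c 1 <= c by rewrite ge_min lexx.
have min1 : Num.min c 1 <= 1 by rewrite ge_min lexx orbT.
have min0 : 0 <= Num.min c 1 by rewrite le_min ler01 andbT ltW.
have cardIG (A : {set T}) : #|A|%:R = #|A :&: G|%:R + #|A :\: G|%:R :> R.
  by rewrite -natrD cardsID.
have leM (a b : nat) : (a <= b)%N -> Num.min c 1 * a%:R <= c * b%:R.
  by move=> ab; rewrite ler_pM // ler_nat.
split=> [i j ij|i vi|i vi|i j ij] /=.
- by apply: disjointW (disj _ _ ij); apply: subsetIl.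
- have [t e d cp b] := trn i vi; split.
  + exact: transitive_setS (subsetIl _ _) t.
  + rewrite e; apply/setP => x; rewrite inE.
    apply/andP/bigcupP => [[/bigcupP[a _ xa] xG]|[a _ /setIP[xa xG]]].
      by exists a => //; rewrite inE xa.
    by split=> //; apply/bigcupP; exists a.
  + by move=> a b' ab; apply: disjointW (d _ _ ab); apply: subsetIl.
  + by move=> a b' ab x y /setIP[xa _] /setIP[yb _]; apply: cp xa yb.
  + move=> a ai; have := b a ai; rewrite (cardIG (mpart _ _ _)) => ba.
    (* All vertices removed from S_i may lie in this one part, so its loss is bounded by that of
       S_i, at most c / 2 * |S_i| <= c / 2 * tr T. *)
    have le1 : (#|mpart chi i a :\: G| <= #|mset chi i :\: G|)%N.
      apply/subset_leq_card/setSD; rewrite e.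
      exact: (bigcup_sup (Ordinal ai)).
    have := mG i; rewrite /mostly; move: le1 (leM _ _ (transitive_set_tr t)).
    rewrite -(ler_nat R); lra.
- have := big i vi; have := mG i; rewrite /mostly.
  have := leM _ _ (max_card (mem (mset chi i))).
  have := cardIG (mset chi i); lra.
- have nij : i != j by apply: contraTneq ij => ->; rewrite ltnn.
  have dij := dens i j ij.
  have [i0 j0] := density_gt0_neq0 (lt_le_trans lam1 dij).
  have half k : #|mset chi k|%:R <= 2 * #|mset chi k :&: G|%:R :> R.
    have := mG k; rewrite /mostly; have := cardIG (mset chi k).
    have : 0 <= #|mset chi k|%:R :> R by [].
    nra.
  have nz k : mset chi k != set0 -> mset chi k :&: G != set0.
    rewrite -!card_gt0 -!(ltr_nat R); have := half k; lra.
  move: dij; rewrite !density_rev_arcs ?nz ?disj //; last first.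
    by apply: disjointW (disj _ _ nij); apply: subsetIl.
  (* Restriction creates no reverse arcs, while each side keeps at least half of its size, hence the
     factor 2 * 2. *)
  have : (rev_arcs (mset chi i :&: G) (mset chi j :&: G))%:R <=
         (rev_arcs (mset chi i) (mset chi j))%:R :> R.
    by rewrite ler_nat rev_arcsS ?subsetIl.
  move=> h1 h2; apply: le_trans h1 (le_trans h2 _).
  rewrite [leRHS](_ : _ = lambda * ((2 * #|mset chi i :&: G|%:R) *
     (2 * #|mset chi j :&: G|%:R))); last by ring.
  by rewrite ler_wpM2l // ler_pM.
Qed.

(** * Misfits and the order of the long representation *)

Definition against chi : rel T := fun x y =>
  [exists i : 'I_m, exists j : 'I_m,
     [&& (i < j)%N, x \in mset chi i, y \in mset chi j & arc y x]].

(** Symmetrized, because a vertex of either copy may carry the smaller label. *)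
Definition misfit chi : rel T := fun x y =>
  against chi x y || against chi y x.

Lemma misfitC chi x y : misfit chi x y = misfit chi y x.
Proof. by rewrite /misfit orbC. Qed.

(** Two entries of the long representation are either parts of one transitive S_i, where
    completeness gives the arc, or lie in S_i and S_j with i < j, where an arc against the order
    would be a misfit. *)
Lemma long_repr_arc (c lambda : R) chi p q x y :
  is_mseq eta c lambda chi -> (p < q)%N ->
  x \in nth set0 (long_repr eta chi) p ->
  y \in nth set0 (long_repr eta chi) q ->
  ~~ misfit chi x y -> arc x y.
Proof.
case=> disj trn _ _ pq xp yq.
have [qs|qs] := ltnP q (size (long_repr eta chi)); last first.
  by rewrite nth_default // inE in yq.
pose r (A B : {set T}) := [forall x in A, forall y in B,
  misfit chi x y || arc x y].
have rP (A B : {set T}) :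
    (forall x y, x \in A -> y \in B -> misfit chi x y || arc x y) -> r A B.
  move=> h; apply/forall_inP => z zA; apply/forall_inP => w wB; exact: h.
have : pairwise r (long_repr eta chi).
  rewrite pairwise_flatten; apply/andP; split.
    apply/allP => _ /mapP[i _ ->]; case: ifP => // vi.
    have [_ _ _ cp _] := trn i vi.
    rewrite pairwise_map; apply/(pairwiseP 0%N) => a b.
    rewrite !inE size_iota => ai bi ab; rewrite !nth_iota //=.
    by apply: rP => z w za wb; rewrite (cp a b) ?orbT // ab.
  have sS (i : 'I_m) A : A \in (if tnth v i then
      [seq mpart chi i a | a <- iota 0 (eta_at eta i)] else [:: mset chi i]) ->
      A \subset mset chi i.
    case: ifP => [/trn[_ -> _ _ _]|_]; last by rewrite inE => /eqP ->.
    case/mapP => a; rewrite mem_iota => /= ai ->.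
    exact: (bigcup_sup (Ordinal ai)).
  rewrite pairwise_map.
  have : pairwise (fun i j : 'I_m => (i < j)%N) (enum 'I_m).
    have := iota_ltn_sorted 0 m; rewrite sorted_pairwise; last exact: ltn_trans.
    by rewrite -val_enum_ord pairwise_map.
  apply: sub_pairwise => i j ij /=; apply/allrelP => A B /sS /subsetP sA.
  move=> /sS /subsetP sB; apply: rP => z w /sA zi /sB wj.
  have zw : z != w.
    apply: contraTneq wj => <-; rewrite (disjointFr _ zi) //.
    by apply: disj; apply: contraTneq ij => ->; rewrite ltnn.
  rewrite (arc_tot zw) orbC -implybE; apply/implyP => awz.
  apply/orP; left; apply/existsP; exists i; apply/existsP; exists j.
  by rewrite ij zi wj.
move/(pairwiseP set0)/(_ p q).
rewrite !inE (ltn_trans pq qs) => /(_ isT qs pq) /forall_inP /(_ x xp).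
by move=> /forall_inP /(_ y yq) /orP[->|].
Qed.

(** For i <> j the misfits are exactly the arcs against the order, which the density condition
    bounds; inside one S_i there are none. *)
Lemma sum_misfit (c lambda : R) chi i j : 0 <= lambda < 1 ->
  is_mseq eta c lambda chi ->
  (\sum_(x in mset chi i) \sum_(y in mset chi j) misfit chi x y)%:R <=
    lambda * (#|mset chi i|%:R * #|mset chi j|%:R).
Proof.
move=> /andP[l0 l1] [disj _ _ dens].
have lam1 : 0 < 1 - lambda by rewrite subr_gt0.
have uniq_idx x i1 i2 : x \in mset chi i1 -> x \in mset chi i2 -> i1 = i2.
  move=> x1 x2; apply/eqP; apply: contraTT x2 => /disj d12.
  by rewrite (disjointFr d12 x1).
have agE x y i1 i2 : x \in mset chi i1 -> y \in mset chi i2 ->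
    against chi x y = (i1 < i2)%N && arc y x.
  move=> x1 y2; apply/existsP/andP => [[a /existsP[b]]|[lt12 ayx]].
    case/and4P=> ab xa yb ayx.
    by rewrite (uniq_idx _ _ _ x1 xa) (uniq_idx _ _ _ y2 yb).
  by exists i1; apply/existsP; exists i2; apply/and4P.
have key (i1 i2 : 'I_m) : (i1 < i2)%N ->
    (rev_arcs (mset chi i1) (mset chi i2))%:R <=
    lambda * (#|mset chi i1|%:R * #|mset chi i2|%:R).
  move=> lt12; have d12 := dens _ _ lt12.
  have [n1 n2] := density_gt0_neq0 (lt_le_trans lam1 d12).
  rewrite -density_rev_arcs //; apply: disj.
  by apply: contraTneq lt12 => ->; rewrite ltnn.
have misE x y : x \in mset chi i -> y \in mset chi j ->
    misfit chi x y = ((i < j)%N && arc y x) || ((j < i)%N && arc x y).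
  by move=> xi yj; rewrite /misfit (agE x y i j) // (agE y x j i).
under eq_bigr => x xi do under eq_bigr => y yj do rewrite misE //.
have [ij|ji|/val_inj ->] := ltngtP i j => /=.
- under eq_bigr => x xi do under eq_bigr => y yj do rewrite orbF.
  exact: key.
- by rewrite exchange_big /= [X in _ * X]mulrC; apply: key.
- by rewrite big1 => [|x _]; rewrite ?big1 // !mulr_ge0.
Qed.

(** * Fitting vertices and vertices compatible with a copy *)

Definition fitting (mu : R) chi : {set T} :=
  [set x | [forall j, (\sum_(y in mset chi j) misfit chi x y)%:R <=
                       mu * #|mset chi j|%:R]].

(** By Markov's inequality, at most lambda / mu * |S_i| vertices of S_i have too many misfits in a
    given S_j; summing over the m values of j produces the factor m * lambda. *)
Lemma mostly_fitting (c lambda mu : R) chi :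
  0 < mu -> 0 <= lambda < 1 ->
  m%:R * lambda <= Num.min c 1 / 2 * mu -> is_mseq eta c lambda chi ->
  forall i, mostly c (mset chi i) (fitting mu chi).
Proof.
move=> mu0 l01 lm chiP i; rewrite /mostly.
set S := mset chi.
pose bad j := [set x in S i |
  mu * #|S j|%:R < (\sum_(y in S j) misfit chi x y)%:R].
have bad_le j : #|bad j|%:R * mu <= lambda * #|S i|%:R.
  (* If S_j is empty, the strict inequality in [bad] reads 0 < 0 and fails; otherwise |S_j| can be
     cancelled. *)
  have [Sj0|Sj0] := eqVneq (S j) set0.
    rewrite (_ : bad j = set0) ?cards0 ?mul0r ?mulr_ge0 //.
      by case/andP: l01.
    by apply/setP => x; rewrite !inE Sj0 big_set0 cards0 mulr0 ltxx andbF.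
  have Sj : 0 < #|S j|%:R :> R by rewrite ltr0n card_gt0.
  rewrite -(ler_pM2r Sj) -!mulrA; apply: le_trans (sum_misfit i j l01 chiP).
  have -> : #|bad j|%:R * (mu * #|S j|%:R) = \sum_(x in bad j) (mu * #|S j|%:R).
    by rewrite sumr_const mulr_natl.
  have sb : bad j \subset S i by apply/subsetP => x; rewrite inE => /andP[].
  have := leq_sum_subset (fun x => \sum_(y in S j) misfit chi x y)%N sb.
  rewrite -(ler_nat R) natr_sum; apply: le_trans.
  by apply: ler_sum => x; rewrite inE => /andP[_ /ltW].
have sub : S i :\: fitting mu chi \subset \bigcup_j bad j.
  apply/subsetP => x; rewrite !inE negb_forall => /andP[/existsP[j xj] xi].
  by apply/bigcupP; exists j => //; rewrite inE xi ltNge.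
rewrite -(ler_pM2r mu0).
have card_le : (#|S i :\: fitting mu chi| <= \sum_j #|bad j|)%N.
  apply: leq_trans (subset_leq_card sub) _.
  apply: (big_ind2 (fun (A : {set T}) n => #|A| <= n)%N) => //.
    by rewrite cards0.
  move=> A a B b leA leB.
  by apply: leq_trans (leq_card_setU A B).1 _; apply: leq_add.
apply: (@le_trans _ _ (\sum_(j < m) lambda * #|S i|%:R)).
  apply: (@le_trans _ _ (\sum_(j < m) #|bad j|%:R * mu)).
    by rewrite -mulr_suml -natr_sum ler_wpM2r ?ler_nat // ltW.
  by apply: ler_sum => j _.
rewrite sumr_const card_ord -[leLHS]mulr_natl mulrA [leRHS]mulrAC.
by rewrite ler_wpM2r.
Qed.

Definition compatible chi (X : {set T}) : {set T} :=
  [set y | [forall x in X, ~~ misfit chi x y]].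

(** Union bound: each vertex of X is fitting, so it rules out at most mu * |S_i| vertices of S_i. *)
Lemma mostly_compatible (c mu : R) chi (X : {set T}) :
  #|X|%:R * mu <= Num.min c 1 / 2 -> X \subset fitting mu chi ->
  forall i, mostly c (mset chi i) (compatible chi X).
Proof.
move=> Xmu /subsetP sX i; rewrite /mostly; set S := mset chi.
have card_le : (#|S i :\: compatible chi X| <=
    \sum_(x in X) \sum_(y in S i) misfit chi x y)%N.
  rewrite exchange_big /= -sum1_card.
  apply: leq_trans (leq_sum_subset _ (subsetDl _ (compatible chi X))).
  (* A removed y has a misfit in X, hence contributes at least 1 to the double sum. *)
  apply: leq_sum => y; rewrite !inE negb_forall_in => /andP[/exists_inP[x xX]].
  by rewrite negbK => mxy _; rewrite (bigD1 x) //= mxy.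
apply: (@le_trans _ _ (\sum_(x in X) mu * #|S i|%:R)).
  rewrite -(ler_nat R) natr_sum in card_le; apply: le_trans card_le _.
  by apply: ler_sum => x /sX; rewrite inE => /forallP.
by rewrite sumr_const -[leLHS]mulr_natl mulrA ler_wpM2r.
Qed.

End MSequence.

(** * Recognizing a copy of the product *)

Section ProductCopy.
Variables (H1 H2 : tournament) (f1 : H1 -> nat) (f2 : H2 -> nat).
Hypotheses (inj1 : injective f1) (inj2 : injective f2) (f12 : orth f1 f2).

(** Backward arcs of the factor are kept, and a pair without backward arc is oriented forward in
    both tournaments. *)
Lemma tprod_arc_l x y :
  @arc (tprod inj1 inj2 f12) (inl x) (inl y) = arc x y.
Proof.
rewrite /= /prod_arc /= /backward; have [lt|lt|/inj1 ->] := ltngtP.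
- by rewrite andbT.
- rewrite andbT -arc_tot //; apply: contraTneq lt => ->.
  by rewrite ltnn.
- by rewrite arc_irr.
Qed.

Lemma tprod_arc_r x y :
  @arc (tprod inj1 inj2 f12) (inr x) (inr y) = arc x y.
Proof.
rewrite /= /prod_arc /= /backward; have [lt|lt|/inj2 ->] := ltngtP.
- by rewrite andbT.
- rewrite andbT -arc_tot //; apply: contraTneq lt => ->.
  by rewrite ltnn.
- by rewrite arc_irr.
Qed.

(** Pairs with one vertex in each factor are never backward in the product, so the arcs across the
    two copies only have to follow the labels. *)
Lemma tprod_copy (T : tournament) (x1 : H1 -> T) (x2 : H2 -> T) :
  injective x1 -> (forall h h', arc (x1 h) (x1 h') = arc h h') ->
  injective x2 -> (forall h h', arc (x2 h) (x2 h') = arc h h') ->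
  (forall h h', (f1 h < f2 h')%N -> arc (x1 h) (x2 h')) ->
  (forall h h', (f2 h' < f1 h)%N -> arc (x2 h') (x1 h)) ->
  injective (oplus x1 x2) /\
  forall z w, arc (oplus x1 x2 z) (oplus x1 x2 w) =
              @arc (tprod inj1 inj2 f12) z w.
Proof.
move=> i1 a1 i2 a2 lt12 lt21.
(* A common vertex of the two copies would carry a loop. *)
have ne h h' : x1 h <> x2 h'.
  move=> e; have [/lt12|/lt21|] := ltngtP (f1 h) (f2 h'); last exact: f12.
    by rewrite e arc_irr.
  by rewrite e arc_irr.
have a12 h h' : arc (x1 h) (x2 h') = (f1 h < f2 h')%N.
  have [/lt12 //|/lt21|/f12 //] := ltngtP (f1 h) (f2 h').
  by rewrite (@arc_tot _ (x1 h)) => [->|]; last apply/eqP/ne.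
have a21 h h' : arc (x2 h') (x1 h) = (f2 h' < f1 h)%N.
  have [/lt12|/lt21 //|/f12 //] := ltngtP (f1 h) (f2 h').
  by rewrite (@arc_tot _ (x2 h')) => [->|]; last apply/eqP/nesym/ne.
split=> [|[z|z] [w|w]].
- exact: oplus_inj.
- by rewrite tprod_arc_l -a1.
- by rewrite /= /prod_arc /= a12; case: ltngtP.
- by rewrite /= /prod_arc /= a21; case: ltngtP.
- by rewrite tprod_arc_r -a2.
Qed.

End ProductCopy.

(** * Combining the two families *)

Theorem theorem9 (R : realType) (m : nat) (v : m.-tuple bool)
    (eta : (zeta v m).-tuple nat)
    (eta_gt0 : forall a, (0 < tnth eta a)%N)
    (r s : nat)
    (H1 : 'I_r -> tournament) (H2 : 'I_s -> tournament)
    (F : forall i, H1 i -> 'I_(long_size eta))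
    (G : forall j, H2 j -> 'I_(long_size eta))
    (injF : forall i, injective (F i)) (injG : forall j, injective (G j))
    (FG : forall i j, orth (F i) (G j)) :
  strong_EH v eta R H1 F -> strong_EH v eta R H2 G ->
  strong_EH v eta R (tprod_family injF injG FG) (oplus_family injF injG FG).
Proof.
move=> EH1 EH2 c c0.
(* Both restrictions are taken from [chi] itself and are not nested, so c / 2 serves for both
   families. *)
have c20 : 0 < c / 2 by rewrite divr_gt0.
have [l1 [d1 [l1_gt0 d1_gt0 P1]]] := EH1 _ c20.
have [l2 [d2 [l2_gt0 d2_gt0 P2]]] := EH2 _ c20.
pose delta := Num.min c 1 / 2.
have delta0 : 0 < delta by rewrite divr_gt0 // lt_min c0 ltr01.
(* Injective labels leave a copy at most [long_size eta] vertices, so with [mu] = [delta] / [k] it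
   rules out at most a fraction [delta] of each S_i. The successor keeps [k] positive. *)
pose k : R := (long_size eta).+1%:R.
have k0 : 0 < k by rewrite ltr0n.
pose mu := delta / k.
have mu0 : 0 < mu by rewrite divr_gt0.
have m0 : 0 < m.+1%:R :> R by rewrite ltr0n.
(* The terms bound 4 * lambda: [l1] and [l2] serve the two families, 1/2 keeps 4 * lambda below 1,
   and the last one feeds the Markov bound, with [m.+1] avoiding a division by 0 when m = 0. *)
pose l3 := Num.min (Num.min l1 l2) (Num.min 2^-1 (delta * mu / m.+1%:R)).
exists (l3 / 4), (Num.min d1 d2); split.
- by rewrite divr_gt0 // !lt_min l1_gt0 l2_gt0 invr_gt0 ltr0n /=
     divr_gt0 // mulr_gt0.
- by rewrite lt_min d1_gt0.
move=> T lambda chi T0 l01 lle chiP; have /andP[l0 _] := l01.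
have : 4 * lambda <= l3 by lra.
rewrite !le_min => /andP[/andP[le1 le2] /andP[le3 le4]].
have l4 : 0 <= 4 * lambda < 1 by apply/andP; lra.
have lm : m%:R * lambda <= Num.min c 1 / 2 * mu.
  move: le4; rewrite ler_pdivlMr // -/delta -natr1.
  have : 0 <= m%:R * lambda by rewrite mulr_ge0.
  lra.
have [|[A [B AB]]] := P1 T _ _ T0 l4 le1
  (is_mseq_restrict c0 l01 chiP (mostly_fitting mu0 l01 lm chiP)); last first.
  right; exists A, B; apply: strong_pair_restrict AB.
  by rewrite ge_min lexx.
move=> [i [x1 [x1F inj1 arc1]]].
pose X := [set x1 h | h : H1 i].
have X_fit : X \subset fitting mu chi.
  apply/subsetP => _ /imsetP[h _ ->].
  by have := x1F h; rewrite nth_long_repr_restrict => /setIP[].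
have Xmu : #|X|%:R * mu <= Num.min c 1 / 2.
  have Xk : #|X|%:R <= k.
    rewrite ler_nat card_imset // ltnW // ltnS -[leqRHS]card_ord.
    exact: leq_card (injF i).
  rewrite -/delta (_ : delta = k * mu) ?ler_wpM2r // 1?ltW //.
  by rewrite /mu mulrC divfK // gt_eqF.
have [|[A [B AB]]] := P2 T _ _ T0 l4 le2
  (is_mseq_restrict c0 l01 chiP (mostly_compatible Xmu X_fit)); last first.
  right; exists A, B; apply: strong_pair_restrict AB.
  by rewrite ge_min lexx orbT.
move=> [j [x2 [x2G inj2 arc2]]]; left.
(* Both copies are moved back to [chi], whose long representation orders them jointly. *)
have {}x1F h : x1 h \in nth set0 (long_repr eta chi) (F i h).
  by have := x1F h; rewrite nth_long_repr_restrict => /setIP[].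
have fit h h' : ~~ misfit chi (x1 h) (x2 h').
  have := x2G h'; rewrite nth_long_repr_restrict => /setIP[_].
  by rewrite inE => /forall_inP; apply; apply: imset_f.
have {}x2G h : x2 h \in nth set0 (long_repr eta chi) (G j h).
  by have := x2G h; rewrite nth_long_repr_restrict => /setIP[].
exists (i, j), (oplus x1 x2).
have x12 h h' : (F i h < G j h')%N -> arc (x1 h) (x2 h').
  by move=> lt; apply: long_repr_arc chiP lt _ _ (fit h h').
have x21 h h' : (G j h' < F i h)%N -> arc (x2 h') (x1 h).
  by move=> lt; apply: long_repr_arc chiP lt _ _ _ => //; rewrite misfitC.
have [inj12 arc12] := tprod_copy (val_comp_inj (@injF i))
  (val_comp_inj (@injG j)) (val_comp_orth (@FG i j))
  inj1 arc1 inj2 arc2 x12 x21.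
by split=> // -[h|h] /=.
Qed.
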